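(* Let $f:\mathbb{R}^n\times\mathbb{R}^m\to\mathbb{R}$ and $r_2:\mathbb{R}^m\to\mathbb{R}\cup\{+\infty\}$ (proper), and set $F(x,y)=f(x,y)+r_2(y)$. Assume: (A1) The partial gradients $\nabla_x f$ and $\nabla_y f$ exist everywhere and there are constants $L_{xx},L_{xy},L_{yx},L_{yy}$ such that for all $x,x'\in\mathbb{R}^n$ and $y,y'\in\mathbb{R}^m$, $$\|\nabla_x f(x,y)-\nabla_x f(x',y)\|\le L_{xx}\|x-x'\|,\qquad \|\nabla_x f(x,y)-\nabla_x f(x,y')\|\le L_{xy}\|y-y'\|,$$ $$\|\nabla_y f(x,y)-\nabla_y f(x',y)\|\le L_{yx}\|x-x'\|,\qquad \|\nabla_y f(x,y)-\nabla_y f(x,y')\|\le L_{yy}\|y-y'\|.$$ (A2) There is $\mu>0$ such that for every $x$, the function $y\mapsto F(x,y)$ is $\mu$-strongly convex. Define $\overline{f}(x)=\min_y F(x,y)$ and $\overline{y}(x)=\operatorname{arg\,min}_y F(x,y)$. Then $\overline{f}$ is differentiable and, for every $x\in\mathbb{R}^n$, $$\nabla\overline{f}(x)=\nabla_x f(x,\overline{y}(x)).$$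
   Context: $\|\cdot\|$ denotes the Euclidean norm. The function $f$ may be non-convex and $r_2$ may be non-smooth (e.g. the indicator function of a constraint set). It is assumed that for every $x$ the minimizer of $F(x,\cdot)$ exists; by strong convexity it is then unique, and $\overline{y}(x)$ denotes it. $\nabla_x f(x,\overline{y}(x))$ denotes the partial gradient of $f$ in its first argument evaluated at the point $(x,\overline{y}(x))$. *)

(* Defs.v *)
From HB Require Import structures.
From mathcomp Require Import all_boot all_order all_algebra.
From mathcomp Require Import all_classical all_reals all_analysis.

Set Implicit Arguments.
Unset Strict Implicit.
Unset Printing Implicit Defensive.

Import Order.TTheory GRing.Theory Num.Theory.
Import numFieldNormedType.Exports.

Local Open Scope classical_set_scope.
Local Open Scope ring_scope.

(* The library norm `|x| on 'rV[R]_n is the max norm; it induces the same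
   topology, hence the same notion of differentiability, as the Euclidean one. *)
Definition enorm (R : realType) (n : nat) (x : 'rV[R]_n) : R :=
  Num.sqrt (\sum_(i < n) x ord0 i ^+ 2).

(* Meaningful where g is differentiable; 'D is a total operator. *)
Definition gradient (R : realType) (n : nat) (g : 'rV[R]_n -> R)
    (x : 'rV[R]_n) : 'rV[R]_n :=
  \row_(i < n) 'D_(delta_mx ord0 i) g x.

Definition grad_x (R : realType) (n m : nat) (f : 'rV[R]_n -> 'rV[R]_m -> R)
    (x : 'rV[R]_n) (y : 'rV[R]_m) : 'rV[R]_n :=
  gradient (fun u => f u y) x.

Definition grad_y (R : realType) (n m : nat) (f : 'rV[R]_n -> 'rV[R]_m -> R)
    (x : 'rV[R]_n) (y : 'rV[R]_m) : 'rV[R]_m :=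
  gradient (fun v => f x v) y.

Definition proper_fun (R : realType) (m : nat) (r : 'rV[R]_m -> \bar R) : Prop :=
  (forall y, r y != -oo%E) /\ (exists y, (r y < +oo)%E).

(* Restricting to 0 < t < 1 loses nothing (at t = 0, 1 the inequality is an
   equality) and avoids the product 0 * +oo. *)
Definition strongly_convex (R : realType) (m : nat) (mu : R)
    (g : 'rV[R]_m -> \bar R) : Prop :=
  forall (u v : 'rV[R]_m) (t : R), 0 < t -> t < 1 ->
    (g ((t *: u + (1 - t) *: v)%R) <=
     t%:E * g u + (1 - t)%:E * g v
       - (mu / 2 * t * (1 - t) * enorm (u - v) ^+ 2)%:E)%E.

Definition is_minimizer (R : realType) (m : nat) (g : 'rV[R]_m -> \bar R)
    (y : 'rV[R]_m) : Prop :=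
  forall z, (g y <= g z)%E.

(* A chosen minimizer; the default value 0 is only returned if none exists. *)
Definition argmin (R : realType) (m : nat) (g : 'rV[R]_m -> \bar R) : 'rV[R]_m :=
  xget 0 [set y | is_minimizer g y].

Definition objective (R : realType) (n m : nat)
    (f : 'rV[R]_n -> 'rV[R]_m -> R) (r2 : 'rV[R]_m -> \bar R)
    (x : 'rV[R]_n) (y : 'rV[R]_m) : \bar R :=
  ((f x y)%:E + r2 y)%E.

Definition ybar (R : realType) (n m : nat)
    (f : 'rV[R]_n -> 'rV[R]_m -> R) (r2 : 'rV[R]_m -> \bar R)
    (x : 'rV[R]_n) : 'rV[R]_m :=
  argmin (objective f r2 x).

(* The infimum over y, which is a minimum whenever a minimizer exists. *)
Definition fbar (R : realType) (n m : nat)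
    (f : 'rV[R]_n -> 'rV[R]_m -> R) (r2 : 'rV[R]_m -> \bar R)
    (x : 'rV[R]_n) : \bar R :=
  ereal_inf (range (objective f r2 x)).

(* Main.v *)
(* Put y0 = ybar x, yu = ybar u and D v = fbar v - f v y0.  Minimality gives
   D u <= D x.  In the other direction, quadratic growth of F x at y0 gives
     D x - D u <= (f u y0 - f u yu) - (f x y0 - f x yu) - mu/4 |yu - y0|^2,
   where by the mean value theorem in x the difference of differences is at most
   Lxy |yu - y0| |u - x|; AM-GM then bounds D x - D u by Lxy^2/mu |u - x|^2.
   Hence D has zero differential at x, and fbar has there the same differential
   as f (., y0). *)
Require Import Defs.
From HB Require Import structures.
From mathcomp Require Import all_boot all_order all_algebra.
From mathcomp Require Import all_classical all_reals all_analysis.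
From mathcomp Require Import lra ring.
Import Order.TTheory GRing.Theory Num.Theory.
Import numFieldNormedType.Exports.
Local Open Scope classical_set_scope.
Local Open Scope ring_scope.

Lemma sqr_enorm {R : realType} {n : nat} (x : 'rV[R]_n) :
  enorm x ^+ 2 = \sum_(i < n) x ord0 i ^+ 2.
Proof. by rewrite sqr_sqrtr// sumr_ge0// => i _; exact: sqr_ge0. Qed.

Lemma enormN {R : realType} {n : nat} (x : 'rV[R]_n) : enorm (- x) = enorm x.
Proof. by congr Num.sqrt; apply: eq_bigr => i _; rewrite mxE sqrrN. Qed.

(** Each squared coordinate is at most the square of the max norm. This converts Euclidean estimates
    into the norm in which differentiability is expressed. *)
Lemma sqr_enorm_le_norm {R : realType} {n : nat} (x : 'rV[R]_n) :
  enorm x ^+ 2 <= n%:R * `|x| ^+ 2.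
Proof.
have -> : n%:R * `|x| ^+ 2 = \sum_(i < n) `|x| ^+ 2.
  by rewrite sumr_const card_ord mulr_natl.
rewrite sqr_enorm ler_sum// => i _.
rewrite -[x ord0 i ^+ 2]ger0_norm ?sqr_ge0// normrX lerXn2r ?nnegrE//.
have -> : `|x| = mx_norm x by [].
rewrite mx_normrE.
exact: (le_bigmax _ (fun ij => `|x ij.1 ij.2|) (ord0, i)).
Qed.

(** With P the inner product and A, B the squared norms, the sum of squares of the entries of B a -
    P b equals B (A B - P^2). Its nonnegativity gives P^2 <= A B when B > 0; when B = 0, b vanishes
    and so does P. *)
Lemma cauchy_schwarz {R : realType} {n : nat} (a b : 'rV[R]_n) :
  `|\sum_(i < n) a ord0 i * b ord0 i| <= enorm a * enorm b.
Proof.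
rewrite -(@ler_pXn2r _ 2)// ?nnegrE ?mulr_ge0 ?sqrtr_ge0//.
rewrite exprMn !sqr_enorm -normrX ger0_norm ?sqr_ge0//.
set P := \sum_i _; set A := \sum_i _; set B := \sum_i _.
have B_ge0 : 0 <= B by rewrite sumr_ge0// => i _; exact: sqr_ge0.
have [B0|Bneq0] := eqVneq B 0.
  rewrite B0 mulr0 [P]big1 ?expr0n// => i _.
  move/eqP: B0; rewrite psumr_eq0; last by move=> *; exact: sqr_ge0.
  move=> /allP/(_ i); rewrite mem_index_enum sqrf_eq0 => /(_ isT)/eqP->.
  by rewrite mulr0.
have : 0 <= \sum_i (B * a ord0 i - P * b ord0 i) ^+ 2.
  by rewrite sumr_ge0// => i _; exact: sqr_ge0.
have -> : \sum_i (B * a ord0 i - P * b ord0 i) ^+ 2 = B * (A * B - P ^+ 2).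
  transitivity (\sum_i B ^+ 2 * a ord0 i ^+ 2
      - \sum_i B * P *+ 2 * (a ord0 i * b ord0 i)
      + \sum_i P ^+ 2 * b ord0 i ^+ 2).
    by rewrite -sumrB -big_split/=; apply: eq_bigr => i _; ring.
  by rewrite -!mulr_sumr -/A -/P -/B; ring.
by rewrite pmulr_rge0 ?subr_ge0// lt_def Bneq0.
Qed.

Lemma diff_gradient {R : realType} {n : nat} (g : 'rV[R]_n -> R)
    (x v : 'rV[R]_n) : differentiable g x ->
  'd g x v = \sum_(i < n) gradient g x ord0 i * v ord0 i.
Proof.
move=> dg; rewrite [in LHS](row_sum_delta v) linear_sum.
by apply: eq_bigr => i _; rewrite linearZ mxE deriveE//= mulrC.
Qed.

Lemma gradientB {R : realType} {n : nat} (g h : 'rV[R]_n -> R) (x : 'rV[R]_n) :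
  differentiable g x -> differentiable h x ->
  gradient (g \- h) x = gradient g x - gradient h x.
Proof.
move=> dg dh; apply/rowP => i; rewrite !mxE.
by rewrite (@deriveB _ _ _ g h)//; exact: diff_derivable.
Qed.

(** Along the segment [l] from [a] to [b], the one-variable mean value theorem yields a point where
    the increment is the inner product of the gradient with [b - a]; Cauchy-Schwarz bounds it. *)
Lemma mean_value_gradient {R : realType} {n : nat} (g : 'rV[R]_n -> R) (K : R)
    (a b : 'rV[R]_n) :
  (forall u, differentiable g u) -> (forall u, enorm (gradient g u) <= K) ->
  `|g b - g a| <= K * enorm (b - a).
Proof.
move=> dg gK.
pose l (t : R^o) := a + t *: (b - a).
have dl t : is_diff t l (fun s => s *: (b - a)).
  by rewrite /l; apply: is_diff_eq; rewrite add0r.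
have dgl (t : R) : is_derive (t : R^o) (1 : R^o) (g \o l) ('d g (l t) (b - a)).
  have dgl : differentiable (g \o l) (t : R^o).
    by apply: differentiable_comp.
  apply: DeriveDef; first exact: diff_derivable.
  by rewrite deriveE// diff_comp//= diff_val scale1r.
have gl_cont : {within `[0, 1], continuous (g \o l)}.
  apply: continuous_subspaceT => t.
  by apply: differentiable_continuous; apply/derivable1_diffP.
have [c _] := MVT ltr01 (fun t _ => dgl t) gl_cont.
rewrite /= /l scale1r scale0r addr0 subrKC subr0 mulr1 => ->.
rewrite diff_gradient//; apply: le_trans (cauchy_schwarz _ _) _.
by rewrite ler_wpM2r ?sqrtr_ge0.
Qed.

(** A quadratic remainder is o(h), so the zero map satisfies the first-order expansion that
    characterizes the differential. *)
Lemma quadratic_diff0 {R : realType} {V W : normedModType R} (g : V -> W)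
    (C : R) (x : V) :
  (forall u, `|g u - g x| <= C * `|u - x| ^+ 2) ->
  differentiable g x /\ 'd g x = \0 :> (V -> W).
Proof.
move=> gC.
have g0 : g \o shift x = cst (g x) + (\0 : V -> W) +o_ 0 id.
  apply/eqaddoP => e e0; near=> h => /=.
  rewrite !fctE/= addr0; apply: le_trans (gC _) _; rewrite addrK.
  (* No sign is assumed for [C]; replacing it by [|C| + 1] gives a positive divisor for the radius
     [e / (|C| + 1)]. *)
  have C1_gt0 : 0 < `|C| + 1 by rewrite ltr_wpDl.
  rewrite expr2 mulrA ler_wpM2r//.
  apply: (@le_trans _ _ ((`|C| + 1) * `|h|)).
    by rewrite ler_wpM2r// (le_trans (ler_norm _))// lerDl.
  rewrite mulrC -ler_pdivlMr// ltW//.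
  by near: h; apply: nbhs0_lt; exact: divr_gt0.
have c0 : continuous (\0 : V -> W) by move=> ?; exact: cvg_cst.
have d0 := diff_unique c0 g0.
by split=> //; apply/diff_locallyP; rewrite d0.
Unshelve. all: by end_near. Qed.

(** Were [r2 y] infinite, the objective at [y] would exceed its value at a point where [r2] is
    finite. *)
Lemma minimizer_fin_num {R : realType} {n m : nat}
    (f : 'rV[R]_n -> 'rV[R]_m -> R) (r2 : 'rV[R]_m -> \bar R) x y :
  proper_fun r2 -> is_minimizer (objective f r2 x) y -> r2 y \is a fin_num.
Proof.
move=> [rNy [z rz]] /(_ z); rewrite /objective fin_numE rNy/=.
by apply: contraTneq => ->; rewrite addey// -ltNge lte_add_pinfty ?ltry.
Qed.

(** Take the midpoint, t = 1/2: g y <= (g z + g y) / 2 - mu/8 |z - y|^2, and double. Letting t tend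
    to 0 would give mu/2, but mu/4 suffices and avoids a limit. *)
Lemma strongly_convex_growth {R : realType} {m : nat} (mu : R)
    (g : 'rV[R]_m -> \bar R) (y z : 'rV[R]_m) :
  strongly_convex mu g -> is_minimizer g y ->
  g y \is a fin_num -> g z \is a fin_num ->
  mu / 4 * enorm (z - y) ^+ 2 <= fine (g z) - fine (g y).
Proof.
move=> gmu gy /fineK gyE /fineK gzE.
have /(gmu z y 2^-1) : 0 < 2^-1 :> R by lra.
rewrite -gyE -gzE => /(_ ltac:(lra)) /(le_trans (gy _)).
by rewrite -gyE -!EFinM -!EFinD lee_fin; lra.
Qed.

Lemma fbarE {R : realType} {n m : nat}
    (f : 'rV[R]_n -> 'rV[R]_m -> R) (r2 : 'rV[R]_m -> \bar R) x y :
  is_minimizer (objective f r2 x) y -> fbar f r2 x = objective f r2 x y.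
Proof.
move=> ymin; apply/eqP; rewrite eq_le; apply/andP; split.
  by apply: ereal_inf_lbound; exists y.
by apply: le_ereal_inf_tmp => _ [z _ <-]; exact: ymin.
Qed.

Theorem theorem2p2 (R : realType) (n m : nat)
    (f : 'rV[R]_n -> 'rV[R]_m -> R) (r2 : 'rV[R]_m -> \bar R)
    (Lxx Lxy Lyx Lyy mu : R)
    (r2_proper : proper_fun r2)
    (f_diff_x : forall (x : 'rV[R]_n) (y : 'rV[R]_m),
      differentiable (fun u => f u y) x)
    (f_diff_y : forall (x : 'rV[R]_n) (y : 'rV[R]_m),
      differentiable (fun v => f x v) y)
    (lip_xx : forall (x x' : 'rV[R]_n) (y : 'rV[R]_m),
      enorm (grad_x f x y - grad_x f x' y) <= Lxx * enorm (x - x'))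
    (lip_xy : forall (x : 'rV[R]_n) (y y' : 'rV[R]_m),
      enorm (grad_x f x y - grad_x f x y') <= Lxy * enorm (y - y'))
    (lip_yx : forall (x x' : 'rV[R]_n) (y : 'rV[R]_m),
      enorm (grad_y f x y - grad_y f x' y) <= Lyx * enorm (x - x'))
    (lip_yy : forall (x : 'rV[R]_n) (y y' : 'rV[R]_m),
      enorm (grad_y f x y - grad_y f x y') <= Lyy * enorm (y - y'))
    (mu_gt0 : 0 < mu)
    (F_strongly_convex : forall x : 'rV[R]_n,
      strongly_convex mu (objective f r2 x))
    (minimizer_exists : forall x : 'rV[R]_n,
      exists y : 'rV[R]_m, is_minimizer (objective f r2 x) y) :
  (forall x : 'rV[R]_n, fbar f r2 x \is a fin_num) /\
  (forall x : 'rV[R]_n,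
     differentiable (fun u => fine (fbar f r2 u)) x /\
     gradient (fun u => fine (fbar f r2 u)) x = grad_x f x (ybar f r2 x)).
Proof.
pose F := objective f r2.
have ymin u : is_minimizer (F u) (ybar f r2 u).
  exact: (xgetPex 0 (minimizer_exists u)).
have r_fin u : r2 (ybar f r2 u) \is a fin_num by exact: minimizer_fin_num (ymin u).
pose r u := fine (r2 (ybar f r2 u)).
have FE u v : F u (ybar f r2 v) = (f u (ybar f r2 v) + r v)%:E.
  by rewrite /F/objective EFinD fineK.
have fbarE' u : fbar f r2 u = (f u (ybar f r2 u) + r u)%:E.
  by rewrite (fbarE _ _ _ _ (ymin u)) -FE.
split=> [x|x]; first by rewrite fbarE'.
pose y0 := ybar f r2 x.
pose D u := fine (fbar f r2 u) - f u y0.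
have growth u v : mu / 4 * enorm (ybar f r2 v - ybar f r2 u) ^+ 2 <=
    f u (ybar f r2 v) + r v - (f u (ybar f r2 u) + r u).
  have := strongly_convex_growth _ _ _ _ (F_strongly_convex u) (ymin u).
  by move=> /(_ (ybar f r2 v)); rewrite -/(F u) !FE; exact.
have D_quad u : `|D u - D x| <= (Lxy ^+ 2 / mu * n%:R) * `|u - x| ^+ 2.
  (* The difference of differences is the increment from [x] to [u] of this single function of the
     first argument, whose gradient [lip_xy] bounds uniformly. *)
  have g_diff v : differentiable ((f ^~ y0) \- (f ^~ (ybar f r2 u))) v.
    exact: differentiableB.
  have g_grad v :
      enorm (gradient ((f ^~ y0) \- (f ^~ (ybar f r2 u))) v) <=
      Lxy * enorm (ybar f r2 u - y0).
    by rewrite gradientB// -opprB enormN; exact: lip_xy.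
  have := mean_value_gradient _ _ x u g_diff g_grad.
  have := sqr_enorm_le_norm (u - x).
  have := growth u x; have := growth x u.
  rewrite -/y0 -[y0 - _]opprB enormN.
  rewrite /D !fbarE' /= -/y0.
  move: (enorm _) (enorm (u - x)) (f x y0) (f u y0) (f x _) (f u _) (r x) (r u).
  move=> d e a b c k rx ru gx gu en_n.
  rewrite ler_norml => /andP[_ dfde].
  (* Here [d] is the distance between the two minimizers and [e] that between [u] and [x]. The
     weight mu/4 matches the growth constant, so the [d ^+ 2] terms cancel. *)
  have amgm : Lxy * d * e <= mu / 4 * d ^+ 2 + Lxy ^+ 2 / mu * e ^+ 2.
    rewrite -subr_ge0.
    have -> : mu / 4 * d ^+ 2 + Lxy ^+ 2 / mu * e ^+ 2 - Lxy * d * e =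
        (mu / 2 * d - Lxy * e) ^+ 2 / mu by field; rewrite gt_eqF.
    by rewrite divr_ge0 ?sqr_ge0// ltW.
  have Lmu_ge0 : 0 <= Lxy ^+ 2 / mu by rewrite divr_ge0 ?sqr_ge0// ltW.
  have mud_ge0 : 0 <= mu / 4 * d ^+ 2.
    by rewrite mulr_ge0 ?sqr_ge0// divr_ge0// ltW.
  have Le_ge0 : 0 <= Lxy ^+ 2 / mu * e ^+ 2 by rewrite mulr_ge0 ?sqr_ge0.
  rewrite -mulrA; apply: le_trans (ler_wpM2l Lmu_ge0 en_n).
  by rewrite ler_norml; lra.
have [D_diff D_diff0] := quadratic_diff0 _ _ _ D_quad.
(* As [y0] stays fixed while [u] varies, the second summand has gradient [grad_x f x y0] at [x], and
   [D] contributes nothing. *)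
have fbar_split : (fun u => fine (fbar f r2 u)) = D \+ (f ^~ y0).
  by apply/funext => u /=; rewrite subrK.
rewrite fbar_split; split; first exact: differentiableD.
apply/rowP => i; rewrite !mxE (@deriveD _ _ _ D (f ^~ y0)); last 2 first.
- exact: diff_derivable.
- exact: diff_derivable.
by rewrite (deriveE _ D_diff) D_diff0 add0r.
Qed.
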